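(* Let $n\ge1$ be an integer, $0<s<n$, and $1\le p,q\le\infty$ with $\frac1p+\frac1q>\frac sn$. Define $r_1,r_2$ by $$\frac1p+\frac1q=\frac1{r_1},\qquad \frac1p+\frac1q=\frac1{r_2}+\frac sn ,$$ and let $A,B>0$ be constants such that for all $f\in L^p(\mathbb R^n)$ and $g\in L^q(\mathbb R^n)$, $$\|\mathcal J_s(f,g)\|_{L^{r_1}}\le A\,\|f\|_{L^p}\|g\|_{L^q},\qquad \|\mathcal J_s(f,g)\|_{L^{r_2,\infty}}\le B\,\|f\|_{L^p}\|g\|_{L^q}.$$ Then for every $0<\theta<1$ and every $0<\alpha\le\infty$ there is a constant $C$, depending only on $n,s,p,q,\theta,\alpha$, such that for all $f\in L^p(\mathbb R^n)$ and $g\in L^q(\mathbb R^n)$, $$\|\mathcal J_s(f,g)\|_{L^{r_\theta,\alpha}}\le C\,A^{1-\theta}B^{\theta}\,\|f\|_{L^p}\|g\|_{L^q},\qquad\text{where}\quad \frac1{r_\theta}=\frac{1-\theta}{r_1}+\frac{\theta}{r_2}.$$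
   Context: For $0<s<n$, $G_s$ denotes the Bessel kernel of order $s$ on $\mathbb R^n$: the nonnegative integrable function whose Fourier transform (with convention $\widehat{h}(\xi)=\int h(x)e^{-2\pi i x\cdot\xi}\,dx$) is $\widehat{G_s}(\xi)=(1+4\pi^2|\xi|^2)^{-s/2}$. The bilinear Bessel potential is $$\mathcal J_s(f,g)(x)=\int_{\mathbb R^n}G_s(y)\,f(x-y)\,g(x+y)\,dy .$$ Lorentz spaces: for a measurable $h$ on $\mathbb R^n$ let $d_h(\lambda)=|\{|h|>\lambda\}|$ and $h^*(t)=\inf\{\lambda>0: d_h(\lambda)\le t\}$. For $0<a<\infty$ and $0<b\le\infty$, $\|h\|_{L^{a,b}}=\left(\int_0^\infty (t^{1/a}h^*(t))^b\,\frac{dt}{t}\right)^{1/b}$ if $b<\infty$ and $\|h\|_{L^{a,\infty}}=\sup_{t>0}t^{1/a}h^*(t)$. Convention: $1/\infty=0$. *)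

(* Defs.v *)
From HB Require Import structures.
From mathcomp Require Import all_boot all_order all_algebra.
From mathcomp Require Import all_classical all_reals all_analysis.
From mathcomp Require Import complex.

Set Implicit Arguments.
Unset Strict Implicit.
Unset Printing Implicit Defensive.

Import Order.TTheory GRing.Theory Num.Theory.
Import numFieldNormedType.Exports.

Local Open Scope classical_set_scope.
Local Open Scope ring_scope.
Local Open Scope complex_scope.

(* [n.-tuple R], with the product of the Borel sigma-algebras, stands for R^n. *)
Section euclidean_operations.
Context {R : realType} {n : nat}.
Implicit Types x y : n.-tuple R.

Definition vadd x y : n.-tuple R := [tuple tnth x i + tnth y i | i < n].
Definition vsub x y : n.-tuple R := [tuple tnth x i - tnth y i | i < n].
Definition vdot x y : R := \sum_(i < n) tnth x i * tnth y i.

End euclidean_operations.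

Section cons_measure.
Context {R : realType} {n : nat}.
Variable mu : {sigma_finite_measure set (n.-tuple R) -> \bar R}.

Definition cons_pair (p : measurableTypeR R * n.-tuple R) : n.+1.-tuple R :=
  [the n.+1.-tuple R of p.1 :: p.2].

Lemma measurable_cons_pair : measurable_fun [set: measurableTypeR R * n.-tuple R] cons_pair.
Proof. exact: measurable_cons. Qed.

(* The product of the one-dimensional Lebesgue measure with [mu], transported
   along R * R^n = R^(n+1). *)
Definition cons_measure : set (n.+1.-tuple R) -> \bar R :=
  pushforward (lebesgue_measure \x mu)%E cons_pair.

Let measurable_preimage_cons (A : set (n.+1.-tuple R)) :
  measurable A -> measurable (cons_pair @^-1` A).
Proof.
by move=> mA; rewrite -[X in measurable X]setTI; exact: measurable_cons_pair.
Qed.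

Let cons_measure0 : cons_measure set0 = 0%E.
Proof. by rewrite /cons_measure /pushforward preimage_set0 measure0. Qed.

Let cons_measure_ge0 A : (0 <= cons_measure A)%E.
Proof. by rewrite /cons_measure /pushforward; apply: measure_ge0. Qed.

Let cons_measure_sigma_additive : semi_sigma_additive cons_measure.
Proof.
move=> F mF tF mUF; rewrite /cons_measure /pushforward preimage_bigcup.
apply: measure_semi_sigma_additive.
- by move=> i; exact: measurable_preimage_cons.
- apply/trivIsetP => /= i j _ _ ij; rewrite -preimage_setI.
  by move/trivIsetP : tF => /(_ _ _ _ _ ij) ->//; rewrite preimage_set0.
- by rewrite -preimage_bigcup; exact: measurable_preimage_cons.
Qed.

HB.instance Definition _ := isMeasure.Build _ _ _ cons_measure
  cons_measure0 cons_measure_ge0 cons_measure_sigma_additive.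

Let cons_measure_sigma_finite : sigma_finite setT cons_measure.
Proof.
have /sigma_finiteP[F [UF ndF Foo]] := sigma_finiteT (@lebesgue_measure R).
have /sigma_finiteP[G [UG ndG Goo]] := sigma_finiteT mu.
pose btail (t : n.+1.-tuple R) := [tuple of behead t].
exists (fun i => (fun t => tnth t ord0) @^-1` F i `&` btail @^-1` G i).
  rewrite predeqE => t; split=> // _.
  have [i _ Fi] : (\bigcup_i F i) (tnth t ord0) by rewrite -UF.
  have [j _ Gj] : (\bigcup_i G i) (btail t) by rewrite -UG.
  exists (maxn i j) => //; split.
    exact: (subsetPset _ _ (ndF _ _ (leq_maxl i j))).
  exact: (subsetPset _ _ (ndG _ _ (leq_maxr i j))).
move=> i; have [mF Fi] := Foo i; have [mG Gi] := Goo i; split.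
  apply: measurableI; rewrite -[X in measurable X]setTI.
    exact: measurable_tnth.
  exact: measurable_behead.
rewrite /cons_measure /pushforward.
rewrite (_ : _ @^-1` _ = F i `*` G i).
  by rewrite product_measure1E// lte_mul_pinfty// ge0_fin_numE.
have btailK p : btail (cons_pair p) = p.2 by exact/val_inj.
by apply/seteqP; split=> p /=; rewrite btailK.
Qed.

HB.instance Definition _ := Measure_isSigmaFinite.Build _ _ _ cons_measure
  cons_measure_sigma_finite.

End cons_measure.

Section lebesgue.
Context {R : realType}.

Fixpoint lebesgue_tuple (n : nat) :
    {sigma_finite_measure set (n.-tuple R) -> \bar R} :=
  if n is n'.+1 then cons_measure (lebesgue_tuple n') else dirac [tuple].

(* Together with sigma-finiteness, the value on boxes characterizes the
   n-dimensional Lebesgue measure. *)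
Lemma lebesgue_tuple_box n (A : 'I_n -> set R) :
  (forall i, measurable (A i)) ->
  lebesgue_tuple n [set x | forall i, A i (tnth x i)] =
  (\prod_(i < n) lebesgue_measure (A i))%E.
Proof.
elim: n A => [|n IH] A mA /=.
  by rewrite big_ord0 diracE mem_set// => -[].
rewrite big_ord_recl -(IH (fun i => A (lift ord0 i)))//.
pose B := [set x : n.-tuple R | forall i, A (lift ord0 i) (tnth x i)].
have mB : measurable B.
  rewrite (_ : B = \bigcap_(i in [set: 'I_n])
      ((@tnth n R ^~ i) @^-1` A (lift ord0 i))).
    apply: fin_bigcap_measurable => // i _.
    by rewrite -[X in measurable X]setTI; exact: measurable_tnth.
  by apply/seteqP; split => x /= Bx => [i _|i]; exact: Bx.
rewrite /cons_measure /pushforward (_ : _ @^-1` _ = A ord0 `*` B).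
  by rewrite product_measure1E; [|exact: mA|exact: mB].
apply/seteqP; split => -[a t] /=.
  move=> At; split; first exact: (At ord0).
  by move=> i; have := At (lift ord0 i); rewrite tnthS.
move=> [Aa At] i; have [j ->|->//] := unliftP ord0 i.
by rewrite tnthS; exact: At.
Qed.

End lebesgue.
Arguments lebesgue_tuple {R} n.

Section complex_functions.
Context d (T : measurableType d) {R : realType}.
Variable mu : {measure set T -> \bar R}.
Implicit Types (h : T -> R[i]) (a lam t : R) (b p : \bar R).

(* Meaningful when the real and imaginary parts of [h] are integrable. *)
Definition cintegral h : R[i] :=
  (\int[mu]_x complex.Re (h x)) +i* (\int[mu]_x complex.Im (h x)).

Definition cabs h : T -> R := fun x => Normc.normc (h x).

Definition lp_norm p h : \bar R := ('N[mu]_p[EFin \o cabs h])%E.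

Definition in_lp p h : Prop :=
  [/\ measurable_fun [set: T] (fun x => complex.Re (h x)),
      measurable_fun [set: T] (fun x => complex.Im (h x)) &
      (lp_norm p h < +oo)%E].

Definition distribution_fun h lam : \bar R := mu [set x | lam < cabs h x].

Definition decreasing_rearr h t : \bar R :=
  ereal_inf [set lam%:E | lam in
    [set lam : R | 0 < lam /\ (distribution_fun h lam <= t%:E)%E]].

(* The value 0 at [b = -oo] is a dummy. *)
Definition lorentz_norm a b h : \bar R :=
  match b with
  | b'%:E => ((\int[lebesgue_measure]_(t in `]0%R, +oo[)
      (((t `^ a^-1)%:E * decreasing_rearr h t) `^ b' * (t^-1)%:E)) `^ b'^-1)%E
  | +oo%E => ereal_sup [set ((t `^ a^-1)%:E * decreasing_rearr h t)%E
                       | t in [set t : R | 0 < t]]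
  | -oo%E => 0%E
  end.

End complex_functions.

Section bessel.
Context {R : realType} {n : nat}.
Implicit Types (x y xi : n.-tuple R) (h f g : n.-tuple R -> R[i]).

Definition cexpi (t : R) : R[i] := cos t +i* sin t.

Definition fourier h xi : R[i] :=
  cintegral (lebesgue_tuple n) (fun x => h x * cexpi (- (2 * pi * vdot x xi))).

(* These properties determine [G] up to a null set; a pointwise value at the
   origin, where the kernel is singular, is immaterial. *)
Definition is_bessel_kernel (s : R) (G : n.-tuple R -> R) : Prop :=
  [/\ forall x, 0 <= G x,
      (lebesgue_tuple n).-integrable [set: n.-tuple R] (EFin \o G) &
      forall xi, fourier (fun x => (G x)%:C) xi =
        ((1 + 4 * pi ^+ 2 * vdot xi xi) `^ (- (s / 2)))%:C].

Definition bilinear_potential (G : n.-tuple R -> R) f g x : R[i] :=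
  cintegral (lebesgue_tuple n)
    (fun y => (G y)%:C * f (vsub x y) * g (vadd x y)).

End bessel.

(* Main.v *)
Require Import Defs.
From mathcomp Require Import all_boot all_order all_algebra.
From mathcomp Require Import all_classical all_reals all_analysis.
From mathcomp Require Import measurable_realfun complex ring.

Import Order.TTheory GRing.Theory Num.Theory.
Import numFieldNormedType.Exports.

Local Open Scope classical_set_scope.
Local Open Scope ring_scope.

(** Write [h = J_s(f,g)], [K = |f|_p |g|_q], [M = A K], [N = B K], and
[delta = 1/r1 - 1/r2 = s/n].  Both hypotheses are statements about the
decreasing rearrangement: the strong bound gives, by Chebyshev's inequality,
[h*(t) <= M t^(-1/r1)], and the weak bound is literally
[h*(t) <= N t^(-1/r2)].  The two right-hand sides cross at
[T = (M/N)^(1/delta)]; measured relative to that point they become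

  [t^(1/r_theta) h*(t) <= L min((t/T)^(-theta delta), (t/T)^((1-theta) delta))]

with [L = M^(1-theta) N^theta].  The minimum decays like a power of [t] at both
ends of [(0,oo)], so its [alpha]-th power is integrable against [dt/t], and
this produces a constant that depends only on [theta], [delta] and [alpha];
when [alpha = oo] the minimum is simply at most 1.  The bilinear structure of
[J_s] enters only through [L = A^(1-theta) B^theta K].

Chebyshev's inequality requires [h] to be measurable, which is the
measurability of a parametrized integral (Fubini--Tonelli).  The degenerate case
[K = 0], in which [T] would make no sense, is absorbed by replacing [K] with
[K + e/D], where [D] is the constant of the conclusion, and letting [e]
tend to 0.

[measurable_cabs_potential], [decreasing_rearr_le_lp_norm],
[decreasing_rearr_le_lorentz_norm] and [integral_peak_le] are the ingredients;
[lorentz_interpolation] combines them on an arbitrary measure space. *)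

(** * Integrals of powers *)

(** The integral of a nonnegative function is a supremum over the simple
functions below it, hence monotone even for non-measurable functions.  This
spares a proof that the rearrangement is a measurable function of [t]. *)
Lemma ge0_integral_monotone d (T : measurableType d) (R : realType)
    (mu : {measure set T -> \bar R}) (D : set T) (f g : T -> \bar R) :
  (forall x, D x -> (0 <= f x)%E) -> (forall x, D x -> (f x <= g x)%E) ->
  (\int[mu]_(x in D) f x <= \int[mu]_(x in D) g x)%E.
Proof.
move=> f0 fg.
have g0 x : D x -> (0 <= g x)%E by move=> Dx; exact: le_trans (f0 _ Dx) (fg _ Dx).
rewrite !(integral_mkcond D) !ge0_integralTE; last 2 first.
- by move=> x; exact: erestrict_ge0.
- by move=> x; exact: erestrict_ge0.
apply: ge_ereal_sup => _ [h /= hf <-]; apply: ereal_sup_ubound => /=.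
by exists h => //= x; apply: le_trans (hf x) _; exact: lee_restrict.
Qed.

Lemma integral_powR_itv (R : realType) (c u v : R) : c != 0 -> 0 < u -> u < v ->
  (\int[lebesgue_measure]_(t in `[u, v]) (t `^ (c - 1))%:E =
   ((v `^ c - u `^ c) / c)%:E)%E.
Proof.
move=> c0 u0 uv.
pose F : R -> R := c^-1 \*: (fun t => t `^ c).
have dF (x : R) : 0 < x -> is_derive x 1 F (x `^ (c - 1)).
  move=> x0.
  rewrite (_ : x `^ (c - 1) = c^-1 *: (c * x `^ (c - 1))).
    by apply: is_deriveZ; exact: is_derive1_powR.
  by rewrite /GRing.scale/= mulKf.
have cF (x : R) : 0 < x -> {for x, continuous F}.
  by move=> /dF[dFx _]; apply: differentiable_continuous; exact/derivable1_diffP.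
rewrite (@continuous_FTC2 _ _ F) //.
- by rewrite /F/= /GRing.scale/= -EFinB -mulrBr mulrC.
- apply: derivable_within_continuous => x; rewrite in_itv/= => /andP[ux _].
  by apply: derivable_powR; rewrite in_itv/= (lt_le_trans u0 ux).
- split.
  + move=> x; rewrite in_itv/= => /andP[ux _].
    by have [] := dF _ (lt_trans u0 ux).
  + by apply: cvg_at_right_filter; exact: cF.
  + by apply: cvg_at_left_filter; apply: cF; exact: lt_trans uv.
- move=> x; rewrite in_itv/= => /andP[ux _].
  by rewrite derive1E; have [_ ->] := dF _ (lt_trans u0 ux).
Qed.

(** The form taken by [integral_powR_itv] in the variable [t / T], with respect
to the scale-invariant measure [dt / t]. *)
Lemma integral_rescaled_powR (R : realType) (K T c u v : R) :
  0 <= K -> 0 < T -> c != 0 -> 0 < u -> u < v ->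
  (\int[lebesgue_measure]_(t in `[u, v]) (K * ((t / T) `^ c * t^-1))%:E =
   (K * (((v / T) `^ c - (u / T) `^ c) / c))%:E)%E.
Proof.
move=> K0 T0 c0 u0 uv; have v0 := lt_trans u0 uv.
transitivity (\int[lebesgue_measure]_(t in `[u, v])
    ((K * T^-1 `^ c)%:E * (t `^ (c - 1))%:E))%E.
  apply: eq_integral => t; rewrite inE/= in_itv/= => /andP[ut _].
  have t0 := lt_le_trans u0 ut.
  rewrite powRM ?invr_ge0 ?ltW// -EFinM powRB ?(gt_eqF t0) ?implybT//.
  by rewrite powRr1 ?ltW//; congr EFin; ring.
rewrite ge0_integralZl_EFin ?mulr_ge0 ?powR_ge0//; last 2 first.
- by move=> t _; rewrite lee_fin powR_ge0.
- apply/measurable_EFinP; apply: measurable_funTS.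
  exact: measurable_powR.
rewrite integral_powR_itv// -EFinM; congr EFin.
rewrite !powRM ?invr_ge0 ?ltW//; ring.
Qed.

(** Below [T] the bound by [(t / T) ^ b] is integrable against [dt / t] and
contributes [1 / b]; above [T] the bound by [(t / T) ^ (- a)] contributes
[1 / a].  The powers are singular or decaying at the ends of the half-line, so
the integral is taken over compact intervals around [T] first. *)
Lemma integral_peak_le (R : realType) (psi : R -> \bar R) (K T a b : R) :
  0 <= K -> 0 < T -> 0 < a -> 0 < b ->
  (forall t, 0 < t -> (0 <= psi t)%E) ->
  (forall t, 0 < t -> (psi t <= (K * (t / T) `^ (- a))%:E)%E) ->
  (forall t, 0 < t -> (psi t <= (K * (t / T) `^ b)%:E)%E) ->
  (\int[lebesgue_measure]_(t in `]0%R, +oo[) (psi t * (t^-1)%:E)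
    <= (K * (a^-1 + b^-1))%:E)%E.
Proof.
move=> K0 T0 a0 b0 psi0 psi_infty psi_zero.
(* The inverse is written as a power so that its measurability is immediate. *)
pose u (t : R) := K * (Num.min ((t / T) `^ b) ((t / T) `^ (- a)) * t `^ (- 1)).
have u0 t : 0 <= u t by rewrite mulr_ge0 ?mulr_ge0 ?le_min ?powR_ge0.
have uE t : 0 < t -> u t =
    K * (Num.min ((t / T) `^ b) ((t / T) `^ (- a)) * t^-1).
  by move=> t0; rewrite /u powR_inv1// ltW.
have mu0 : measurable_fun [set: R] u.
  apply: measurable_funM => //.
  apply: measurable_funM; last exact: measurable_powR.
  by apply: measurable_minr;
    apply: (@measurableT_comp _ _ _ _ _ _ (@powR R ^~ _));
    [exact: measurable_powR|exact: measurable_funM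
    |exact: measurable_powR|exact: measurable_funM].
have mEu D : measurable_fun D (EFin \o u).
  by apply: measurable_funTS; exact/measurable_EFinP.
apply: (@le_trans _ _
    (\int[lebesgue_measure]_(t in `]0%R, +oo[) (u t)%:E)%E).
  apply: ge0_integral_monotone => t; rewrite /= in_itv/= andbT => t0.
    by rewrite mule_ge0 ?psi0// lee_fin invr_ge0 ltW.
  rewrite uE// mulrA EFinM; apply: lee_wpmul2r.
    by rewrite lee_fin invr_ge0 ltW.
  have [le_ba|lt_ab] := leP ((t / T) `^ b) ((t / T) `^ (- a)).
    exact: psi_zero.
  exact: psi_infty.
(* The offset 2 keeps T strictly inside each interval. *)
pose F (i : nat) : set (measurableTypeR R) := `[T / i.+2%:R, T * i.+2%:R]%classic.
have lo0 (i : nat) : 0 < T / i.+2%:R by rewrite divr_gt0.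
have loT (i : nat) : T / i.+2%:R < T by rewrite gtr_pMr// invf_lt1 // ltr1n.
have hiT (i : nat) : T < T * i.+2%:R by rewrite ltr_pMr// ltr1n.
have FE : `]0, +oo[%classic = \bigcup_i F i :> set R.
  apply/seteqP; split=> t /=; rewrite in_itv/= andbT; last first.
    by move=> [i _]; rewrite /F/= in_itv/= => /andP[+ _]; exact: lt_le_trans.
  move=> t0; pose m := Num.max (t / T) (T / t).
  have mk : m <= (Num.truncn m).+2%:R.
    by rewrite (le_trans (ltW (truncnS_gt m)))// ler_nat.
  have [tm Tm] : t / T <= (Num.truncn m).+2%:R /\
      T / t <= (Num.truncn m).+2%:R.
    by apply/andP; rewrite -ge_max.
  exists (Num.truncn m) => //; rewrite /F/= in_itv/=.
  rewrite ler_pdivrMr// -ler_pdivrMl// [_^-1 * _]mulrC Tm/=.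
  by rewrite -ler_pdivrMl// mulrC.
have ndF : {homo F : i j / (i <= j)%N >-> (i <= j)%O}.
  move=> i j ij; apply/subsetPset => t; rewrite /F/= !in_itv/= => /andP[ut tu].
  rewrite (le_trans _ ut) ?(le_trans tu)//.
    by rewrite ler_pM2l// ler_nat !ltnS.
  by rewrite ler_pM2l// lef_pV2 ?posrE// ler_nat !ltnS.
have mF i : measurable (F i) by exact: measurable_itv.
have cvF := @ge0_nondecreasing_set_cvg_integral _ (measurableTypeR R) R F
  (EFin \o u)
  lebesgue_measure ndF mF (fun i => mEu (F i)) (fun i t _ => u0 t).
rewrite FE -(cvg_lim _ cvF)//.
apply: lime_le; first by apply/cvg_ex; eexists; exact: cvF.
apply: nearW => i.
pose A : set (measurableTypeR R) := `[T / i.+2%:R, T]%classic;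
  pose B : set (measurableTypeR R) := `]T, T * i.+2%:R]%classic.
have -> : F i = A `|` B.
  by rewrite /A /B -itv_bndbnd_setU// bnd_simp ltW.
rewrite ge0_integral_setU; first last.
- apply/disj_setPRL => x; rewrite /A /B /= !in_itv/= => /andP[Tx _].
  by move=> /andP[_]; rewrite leNgt Tx.
- by move=> x _; rewrite lee_fin.
- exact: mEu.
- exact: measurable_itv.
- exact: measurable_itv.
rewrite [a^-1 + _]addrC mulrDr EFinD; apply: leeD.
  apply: (@le_trans _ _ (\int[lebesgue_measure]_(t in A)
     (K * ((t / T) `^ b * t^-1))%:E)%E).
    apply: ge0_integral_monotone => t; first by rewrite lee_fin u0.
    rewrite /A/= in_itv/= => /andP[ut _]; have t0 := lt_le_trans (lo0 i) ut.
    rewrite lee_fin uE// ler_wpM2l// ler_wpM2r ?invr_ge0 ?(ltW t0)//.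
    by rewrite ge_min lexx.
  rewrite integral_rescaled_powR ?gt_eqF// lee_fin.
  rewrite ler_wpM2l// divff ?gt_eqF// powR1.
  by rewrite ler_pdivrMr// mulVf ?gt_eqF// gerBl powR_ge0.
apply: (@le_trans _ _ (\int[lebesgue_measure]_(t in `[T, (T * i.+2%:R)%R])
   (u t)%:E)%E).
  apply: ge0_subset_integral.
  - exact: measurable_itv.
  - exact: measurable_itv.
  - exact: mEu.
  - by move=> t _; rewrite lee_fin.
  - by move=> t; rewrite /B/= !in_itv/= => /andP[/ltW -> ->].
apply: (@le_trans _ _ (\int[lebesgue_measure]_(t in `[T, (T * i.+2%:R)%R])
   (K * ((t / T) `^ (- a) * t^-1))%:E)%E).
  apply: ge0_integral_monotone => t; first by rewrite lee_fin u0.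
  rewrite /= in_itv/= => /andP[Tt _]; have t0 := lt_le_trans T0 Tt.
  rewrite lee_fin uE// ler_wpM2l// ler_wpM2r ?invr_ge0 ?(ltW t0)//.
  by rewrite ge_min lexx orbT.
rewrite integral_rescaled_powR ?oppr_eq0 ?gt_eqF// lee_fin.
rewrite ler_wpM2l// divff ?gt_eqF// powR1 invrN mulrN -mulNr opprB.
by rewrite ler_pdivrMr// mulVf ?gt_eqF// gerBl powR_ge0.
Qed.

(** * Measurability of the bilinear potential *)

(** Fubini--Tonelli gives this for the integrals of the positive and negative
parts; no integrability is required because both the difference of extended
reals and the projection [fine] are measurable total operations. *)
Lemma measurable_Rintegral_section d1 d2 (T1 : measurableType d1)
    (T2 : measurableType d2) (R : realType)
    (mu : {sigma_finite_measure set T2 -> \bar R}) (F : T1 * T2 -> R) :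
  measurable_fun [set: T1 * T2] F ->
  measurable_fun [set: T1] (fun x => \int[mu]_y F (x, y)).
Proof.
move=> mF; have mEF : measurable_fun [set: T1 * T2] (EFin \o F).
  exact/measurable_EFinP.
apply: (@measurableT_comp _ _ _ _ _ _ fine); first exact: fine_measurable.
rewrite (_ : (fun x => _) = fun x => (fubini_F mu (EFin \o F)^\+ x
    - fubini_F mu (EFin \o F)^\- x)%E).
  by apply: emeasurable_funB; apply: measurable_fun_fubini_tonelli_F => //;
    [exact: measurable_funepos|exact: measurable_funeneg].
apply/funext => x; rewrite integralE; congr (_ - _)%E;
  by apply: eq_integral => y _; rewrite ?funeposE ?funenegE.
Qed.

Section potential_measurability.
Context {R : realType} {n : nat}.

Lemma measurable_vsub :
  measurable_fun [set: n.-tuple R * n.-tuple R] (fun z => vsub z.1 z.2).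
Proof.
apply/measurable_fun_tnthP => i.
rewrite (_ : _ \o _ = fun z => tnth z.1 i - tnth z.2 i).
  by apply: measurable_funB;
    apply: (@measurableT_comp _ _ _ _ _ _ (@tnth n R ^~ i));
    rewrite //; exact: measurable_tnth.
by apply/funext => z; rewrite /= tnth_mktuple.
Qed.

Lemma measurable_vadd :
  measurable_fun [set: n.-tuple R * n.-tuple R] (fun z => vadd z.1 z.2).
Proof.
apply/measurable_fun_tnthP => i.
rewrite (_ : _ \o _ = fun z => tnth z.1 i + tnth z.2 i).
  by apply: measurable_funD;
    apply: (@measurableT_comp _ _ _ _ _ _ (@tnth n R ^~ i));
    rewrite //; exact: measurable_tnth.
by apply/funext => z; rewrite /= tnth_mktuple.
Qed.

Lemma Re_realMM (a : R) (z w : R[i]) : complex.Re ((a%:C)%C * z * w) =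
  a * (complex.Re z * complex.Re w - complex.Im z * complex.Im w).
Proof. by case: z w => [z1 z2] [w1 w2] /=; ring. Qed.

Lemma Im_realMM (a : R) (z w : R[i]) : complex.Im ((a%:C)%C * z * w) =
  a * (complex.Re z * complex.Im w + complex.Im z * complex.Re w).
Proof. by case: z w => [z1 z2] [w1 w2] /=; ring. Qed.

Lemma measurable_cabs d (T : measurableType d) (h : T -> R[i]) :
  measurable_fun [set: T] (fun x => complex.Re (h x)) ->
  measurable_fun [set: T] (fun x => complex.Im (h x)) ->
  measurable_fun [set: T] (cabs h).
Proof.
move=> mRe mIm.
rewrite (_ : cabs h = fun x =>
    (complex.Re (h x) ^+ 2 + complex.Im (h x) ^+ 2) `^ 2^-1).
  apply: (@measurableT_comp _ _ _ _ _ _ (@powR R ^~ 2^-1)).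
    exact: measurable_powR.
  by apply: measurable_funD; exact: measurable_funX.
apply/funext => x; rewrite powR12_sqrt ?addr_ge0 ?sqr_ge0//.
by rewrite /cabs; case: (h x).
Qed.

Lemma measurable_cabs_potential
    (G : n.-tuple R -> R) (f g : n.-tuple R -> R[i]) :
  measurable_fun [set: n.-tuple R] G ->
  measurable_fun [set: n.-tuple R] (fun x => complex.Re (f x)) ->
  measurable_fun [set: n.-tuple R] (fun x => complex.Im (f x)) ->
  measurable_fun [set: n.-tuple R] (fun x => complex.Re (g x)) ->
  measurable_fun [set: n.-tuple R] (fun x => complex.Im (g x)) ->
  measurable_fun [set: n.-tuple R] (cabs (bilinear_potential G f g)).
Proof.
move=> mG mRf mIf mRg mIg.
have mG2 : measurable_fun [set: n.-tuple R * n.-tuple R] (fun z => G z.2).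
  exact: measurableT_comp.
have msub (k : n.-tuple R -> R) : measurable_fun [set: n.-tuple R] k ->
    measurable_fun [set: n.-tuple R * n.-tuple R] (fun z => k (vsub z.1 z.2)).
  by move=> mk; apply: measurableT_comp => //; exact: measurable_vsub.
have madd (k : n.-tuple R -> R) : measurable_fun [set: n.-tuple R] k ->
    measurable_fun [set: n.-tuple R * n.-tuple R] (fun z => k (vadd z.1 z.2)).
  by move=> mk; apply: measurableT_comp => //; exact: measurable_vadd.
apply: measurable_cabs => /=.
- apply: (@measurable_Rintegral_section _ _ _ _ _ _
    (fun z => complex.Re (((G z.2)%:C)%C * f (vsub z.1 z.2) * g (vadd z.1 z.2)))).
  under eq_fun do rewrite Re_realMM.
  apply: measurable_funM => //; apply: measurable_funB;
    by apply: measurable_funM; [exact: (msub _ mRf) || exact: (msub _ mIf)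
      |exact: (madd _ mRg) || exact: (madd _ mIg)].
- apply: (@measurable_Rintegral_section _ _ _ _ _ _
    (fun z => complex.Im (((G z.2)%:C)%C * f (vsub z.1 z.2) * g (vadd z.1 z.2)))).
  under eq_fun do rewrite Im_realMM.
  apply: measurable_funM => //; apply: measurable_funD;
    by apply: measurable_funM; [exact: (msub _ mRf) || exact: (msub _ mIf)
      |exact: (madd _ mRg) || exact: (madd _ mIg)].
Qed.

End potential_measurability.

(** * Bounds on the decreasing rearrangement *)

Section rearrangement.
Context d (T : measurableType d) {R : realType}.
Variable (mu : {measure set T -> \bar R}).
Implicit Types h : T -> R[i].

Lemma decreasing_rearr_ge0 h t : (0 <= decreasing_rearr mu h t)%E.
Proof.
by apply: le_ereal_inf_tmp => _ [lam [lam0 _] <-]; rewrite lee_fin ltW.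
Qed.

(** The infimum defining [decreasing_rearr] only ranges over positive levels, so
the hypothesis concerns the levels above [c] and [c = 0] is allowed. *)
Lemma decreasing_rearr_le h t c : 0 <= c ->
  (forall lam, c < lam -> (distribution_fun mu h lam <= t%:E)%E) ->
  (decreasing_rearr mu h t <= c%:E)%E.
Proof.
move=> c0 hc; apply/lee_addgt0Pr => e e0.
apply: ereal_inf_lbound; exists (c + e); last by rewrite EFinD.
split; first by rewrite ltr_wpDl.
by apply: hc; rewrite ltrDl.
Qed.

(** Chebyshev's inequality: the set where [|h|] exceeds [lam] has measure at
most [(M / lam) ^ r], and this is at most [t] as soon as
[lam >= M * t ^ (- 1 / r)]. *)
Lemma decreasing_rearr_le_lp_norm h (r M t : R) : 0 < r -> 0 < M -> 0 < t ->
  measurable_fun [set: T] (cabs h) -> (lp_norm mu r%:E h <= M%:E)%E ->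
  (decreasing_rearr mu h t <= (M * t `^ (- r^-1))%:E)%E.
Proof.
move=> r0 M0 t0 mh hM.
apply: decreasing_rearr_le => [|lam]; first by rewrite mulr_ge0 ?powR_ge0// ltW.
set c := M * _ => clam.
have c0 : 0 < c by rewrite mulr_gt0 ?powR_gt0.
have lam0 : 0 < lam by exact: lt_trans clam.
have cr : c `^ r = M `^ r * t^-1.
  rewrite powRM ?powR_ge0 ?ltW// -powRrM mulNr mulVf ?gt_eqF//.
  by rewrite powR_inv1 ?ltW.
have mE : measurable_fun [set: T] (EFin \o cabs h) by exact/measurable_EFinP.
have chebyshev := @le_integral_comp_abse _ T R mu setT measurableT
  (EFin \o cabs h) lam (fun x => x `^ r)%E (measurable_poweR r)
  (fun x _ => poweR_ge0 x r) _ mE lam0.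
have int_le : (\int[mu]_x `|(EFin \o cabs h) x| `^ r <= (M `^ r)%:E)%E.
  rewrite -powR_Lnorm ?gt_eqF// -poweR_EFin.
  apply: gt0_ler_poweR; rewrite ?in_itv/= ?leey ?lee_fin ?(ltW r0) ?(ltW M0)//.
  by rewrite /lp_norm Lnorm_ge0.
have mle : measurable [set x | (lam%:E <= `|(EFin \o cabs h) x|)%E].
  rewrite -[X in measurable X]setTI.
  by apply: emeasurable_fun_c_infty => //; exact: measurableT_comp.
have dist_le : (distribution_fun mu h lam <=
    mu (setT `&` [set x | lam%:E <= `|(EFin \o cabs h) x|]))%E.
  rewrite setTI; apply: le_measure; rewrite ?inE//.
    rewrite /distribution_fun (_ : [set x | _] =
      setT `&` [set x | (lam%:E < (EFin \o cabs h) x)%E]).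
      exact: emeasurable_fun_o_infty.
    by rewrite setTI; apply/seteqP; split=> x /=; rewrite lte_fin.
  by move=> x /= lamx; rewrite lee_fin (le_trans (ltW lamx))// ler_norm.
apply: le_trans dist_le _.
have {chebyshev} := le_trans (chebyshev _) int_le.
set m := mu _; rewrite -lee_pdivlMl ?powR_gt0// => /(_ _)/le_trans; apply.
  move=> x y; rewrite !inE/= !in_itv/= !andbT => x0 y0 xy.
  by apply: gt0_ler_poweR; rewrite ?in_itv/= ?leey ?(ltW r0) ?x0 ?y0.
rewrite -EFinM lee_fin ler_pdivrMl ?powR_gt0// -ler_pdivrMr//.
by rewrite -cr ge0_ler_powR ?nnegrE// ltW.
Qed.

Lemma decreasing_rearr_le_lorentz_norm h (r N t : R) : 0 < t ->
  (lorentz_norm mu r +oo h <= N%:E)%E ->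
  (decreasing_rearr mu h t <= (N * t `^ (- r^-1))%:E)%E.
Proof.
move=> t0 hN.
have : ((t `^ r^-1)%:E * decreasing_rearr mu h t <= N%:E)%E.
  by apply: le_trans hN; apply: ereal_sup_ubound; exists t.
by rewrite powRN -lee_pdivlMl ?powR_gt0// muleC.
Qed.

End rearrangement.

(** * Interpolation between strong and weak bounds *)

(** For [alpha = a] finite this is the [1 / a]-th power of the integral of
[min(x ^ (- theta delta), x ^ ((1 - theta) delta)) ^ a] against [dx / x]. *)
Definition interpolation_constant {R : realType} (theta delta : R)
    (alpha : \bar R) : R :=
  if alpha is a%:E
  then ((theta * delta * a)^-1 + ((1 - theta) * delta * a)^-1) `^ a^-1 else 1.

Lemma interpolation_constant_gt0 (R : realType) (theta delta : R) (alpha : \bar R) :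
  0 < theta < 1 -> 0 < delta -> (0 < alpha)%E ->
  0 < interpolation_constant theta delta alpha.
Proof.
move=> /andP[th0 th1] de0; case: alpha => [a||]//=; rewrite lte_fin => a0.
by rewrite powR_gt0// addr_gt0// invr_gt0 !mulr_gt0// subr_gt0.
Qed.

(** A function whose rearrangement lies below two different powers of [t] is
compared with the minimum of the two, rescaled to peak at their crossing
point. *)
Lemma lorentz_interpolation d (T : measurableType d) (R : realType)
    (mu : {measure set T -> \bar R}) (h : T -> R[i])
    (r1 r2 theta rtheta M N : R) (alpha : \bar R) :
  r2^-1 < r1^-1 -> 0 < theta < 1 ->
  rtheta^-1 = (1 - theta) / r1 + theta / r2 -> (0 < alpha)%E ->
  0 < M -> 0 < N ->
  (forall t, 0 < t ->
    (decreasing_rearr mu h t <= (M * t `^ (- r1^-1))%:E)%E) ->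
  (forall t, 0 < t ->
    (decreasing_rearr mu h t <= (N * t `^ (- r2^-1))%:E)%E) ->
  (lorentz_norm mu rtheta alpha h <=
   (interpolation_constant theta (r1^-1 - r2^-1) alpha *
    (M `^ (1 - theta) * N `^ theta))%:E)%E.
Proof.
move=> r21 /andP[th0 th1] rthE al0 M0 N0 hM hN.
set de := r1^-1 - r2^-1; have de0 : 0 < de by rewrite subr_gt0.
have th1' : 0 < 1 - theta by rewrite subr_gt0.
set K := M `^ (1 - theta) * N `^ theta.
have K0 : 0 < K by rewrite mulr_gt0 ?powR_gt0.
(* The two bounds cross at [t0], where [t ^ (1 / rtheta)] times either of them
   equals [K]. *)
pose t0 := (M / N) `^ de^-1.
have MN0 : 0 < M / N by rewrite divr_gt0.
have t00 : 0 < t0 by rewrite powR_gt0.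
have scale t c : 0 < t -> (t / t0) `^ (c * de) = t `^ (c * de) * (M / N) `^ (- c).
  move=> t_gt0; rewrite [LHS]powRM ?invr_ge0 ?(ltW t_gt0) ?(ltW t00)//.
  congr (_ * _).
  by rewrite /t0 -powRN -powRrM; congr (_ `^ _); field; rewrite gt_eqF.
have ratio c : (M / N) `^ c = M `^ c * N `^ (- c).
  rewrite powRM ?invr_ge0 ?(ltW M0) ?(ltW N0)//; congr (_ * _).
  by rewrite -powR_inv1 ?(ltW N0)// -powRrM mulN1r.
pose psi t := ((t `^ rtheta^-1)%:E * decreasing_rearr mu h t)%E.
have psi0 t : (0 <= psi t)%E.
  by rewrite mule_ge0 ?lee_fin ?powR_ge0 ?decreasing_rearr_ge0.
have psi_infty t : 0 < t -> (psi t <= (K * (t / t0) `^ (- theta * de))%:E)%E.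
  move=> t_gt0; apply: (le_trans (lee_wpmul2l _ (hM t t_gt0))).
    by rewrite lee_fin powR_ge0.
  rewrite -EFinM lee_fin scale// ratio opprK.
  rewrite (_ : K * _ = (M `^ (1 - theta) * M `^ theta) *
      (N `^ theta * N `^ (- theta)) * t `^ (- theta * de)); last first.
    by rewrite /K; ring.
  rewrite -!powRD ?(gt_eqF M0) ?(gt_eqF N0) ?implybT// subrr subrK.
  rewrite powRr0 powRr1 ?(ltW M0)// mulr1 mulrCA -powRD ?(gt_eqF t_gt0) ?implybT//.
  suff -> : rtheta^-1 - r1^-1 = - theta * de by [].
  by rewrite rthE /de; ring.
have psi_zero t : 0 < t -> (psi t <= (K * (t / t0) `^ ((1 - theta) * de))%:E)%E.
  move=> t_gt0; apply: (le_trans (lee_wpmul2l _ (hN t t_gt0))).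
    by rewrite lee_fin powR_ge0.
  rewrite -EFinM lee_fin scale// ratio opprK.
  rewrite (_ : K * _ = (M `^ (1 - theta) * M `^ (- (1 - theta))) *
      (N `^ theta * N `^ (1 - theta)) * t `^ ((1 - theta) * de)); last first.
    by rewrite /K; ring.
  rewrite -!powRD ?(gt_eqF M0) ?(gt_eqF N0) ?implybT// subrr addrC subrK.
  rewrite powRr0 powRr1 ?(ltW N0)// mul1r mulrCA -powRD ?(gt_eqF t_gt0) ?implybT//.
  suff -> : rtheta^-1 - r2^-1 = (1 - theta) * de by [].
  by rewrite rthE /de; ring.
have one_powR c : 1 `^ c = 1 :> R by rewrite powR1.
case: alpha al0 => [a| |]//=; last first.
  move=> _; apply: ge_ereal_sup => _ [t t_gt0 <-]; rewrite mul1r -/(psi t).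
  have [tt0|/ltW t0t] := leP t t0.
    apply: (le_trans (psi_zero t t_gt0)); rewrite lee_fin ler_piMr ?(ltW K0)//.
    rewrite -[leRHS](one_powR ((1 - theta) * de)) ge0_ler_powR ?nnegrE//.
    - by rewrite mulr_ge0 ?ltW.
    - by rewrite divr_ge0 ?ltW.
    - by rewrite ler_pdivrMr// mul1r.
  apply: (le_trans (psi_infty t t_gt0)); rewrite lee_fin ler_piMr ?(ltW K0)//.
  rewrite mulNr powRN invf_le1 ?powR_gt0 ?divr_gt0//.
  rewrite -[leLHS](one_powR (theta * de)) ge0_ler_powR ?nnegrE//.
  - by rewrite mulr_ge0 ?ltW.
  - by rewrite divr_ge0 ?ltW.
  - by rewrite ler_pdivlMr// mul1r.
rewrite lte_fin => a0.
have powa c t : 0 < t -> (psi t <= (K * (t / t0) `^ c)%:E)%E ->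
    (psi t `^ a <= (K `^ a * (t / t0) `^ (c * a))%:E)%E.
  move=> t_gt0 le_psi.
  have -> : (K `^ a * (t / t0) `^ (c * a))%:E = ((K * (t / t0) `^ c)%:E `^ a)%E.
    by rewrite poweR_EFin powRM ?powR_ge0 ?(ltW K0)// powRrM.
  apply: gt0_ler_poweR => //; rewrite ?in_itv/= ?leey ?andbT ?psi0 ?(ltW a0)//.
  by rewrite lee_fin mulr_ge0 ?powR_ge0 ?ltW.
have int_le :
    (\int[lebesgue_measure]_(t in `]0%R, +oo[) (psi t `^ a * (t^-1)%:E) <=
    (K `^ a * ((theta * de * a)^-1 + ((1 - theta) * de * a)^-1))%:E)%E.
  apply: (@integral_peak_le R (fun t => psi t `^ a)%E _ t0);
    rewrite ?powR_ge0 ?mulr_gt0//.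
  - by move=> t _; exact: poweR_ge0.
  - by move=> t t_gt0; rewrite -!mulNr; apply: powa => //; exact: psi_infty.
  - by move=> t t_gt0; apply: powa => //; exact: psi_zero.
have Sge0 : 0 <= (theta * de * a)^-1 + ((1 - theta) * de * a)^-1.
  by rewrite addr_ge0// invr_ge0 !mulr_ge0// ltW.
set S := _ + _ in int_le Sge0 *.
have -> : (S `^ a^-1 * K)%:E = ((K `^ a * S)%:E `^ a^-1)%E.
  rewrite poweR_EFin powRM ?powR_ge0// -powRrM mulfV ?gt_eqF// powRr1 ?ltW//.
  by rewrite mulrC.
apply: gt0_ler_poweR int_le; rewrite ?in_itv/= ?leey ?andbT ?invr_ge0 ?(ltW a0)//.
  apply: integral_ge0 => t; rewrite /= in_itv/= andbT => t_gt0.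
  by rewrite mule_ge0 ?poweR_ge0// lee_fin invr_ge0 ltW.
by rewrite lee_fin mulr_ge0 ?powR_ge0.
Qed.

Theorem lemma6p4 (R : realType) (n : nat) (s : R) (p q : \bar R)
    (r1 r2 theta rtheta : R) (alpha : \bar R)
    (n_ge1 : (1 <= n)%N) (s_gt0 : 0 < s) (s_ltn : s < n%:R)
    (p_ge1 : (1 <= p)%E) (q_ge1 : (1 <= q)%E)
    (pq_s : ((s / n%:R)%:E < p^-1 + q^-1)%E)
    (r1E : (p^-1 + q^-1)%E = (r1^-1)%:E)
    (r2E : (p^-1 + q^-1)%E = (r2^-1 + s / n%:R)%:E)
    (theta_gt0 : 0 < theta) (theta_lt1 : theta < 1)
    (alpha_gt0 : (0 < alpha)%E)
    (rthetaE : rtheta^-1 = (1 - theta) / r1 + theta / r2) :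
  exists2 C : R, 0 < C &
  forall G : n.-tuple R -> R, is_bessel_kernel s G ->
  forall A B : R, 0 < A -> 0 < B ->
  (forall f g : n.-tuple R -> R[i],
     in_lp (lebesgue_tuple n) p f -> in_lp (lebesgue_tuple n) q g ->
     (lp_norm (lebesgue_tuple n) r1%:E (bilinear_potential G f g)
      <= A%:E * (lp_norm (lebesgue_tuple n) p f *
                 lp_norm (lebesgue_tuple n) q g))%E) ->
  (forall f g : n.-tuple R -> R[i],
     in_lp (lebesgue_tuple n) p f -> in_lp (lebesgue_tuple n) q g ->
     (lorentz_norm (lebesgue_tuple n) r2 +oo (bilinear_potential G f g)
      <= B%:E * (lp_norm (lebesgue_tuple n) p f *
                 lp_norm (lebesgue_tuple n) q g))%E) ->
  forall f g : n.-tuple R -> R[i],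
    in_lp (lebesgue_tuple n) p f -> in_lp (lebesgue_tuple n) q g ->
    (lorentz_norm (lebesgue_tuple n) rtheta alpha (bilinear_potential G f g)
     <= (C * A `^ (1 - theta) * B `^ theta)%:E *
        (lp_norm (lebesgue_tuple n) p f *
         lp_norm (lebesgue_tuple n) q g))%E.
Proof.
set de := s / n%:R; set C := interpolation_constant theta de alpha.
have n0 : 0 < n%:R :> R by rewrite ltr0n.
have de0 : 0 < de by rewrite divr_gt0.
have r1_de : de < r1^-1 by rewrite -lte_fin -r1E.
have r12 : r1^-1 = r2^-1 + de by apply: EFin_inj; rewrite -r1E.
have r1_gt0 : 0 < r1 by rewrite -invr_gt0 (lt_trans de0).
have deE : r1^-1 - r2^-1 = de by rewrite r12 addrC addKr.
have C0 : 0 < C by rewrite interpolation_constant_gt0 ?theta_gt0.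
exists C => // G [_ /integrableP[/measurable_EFinP mG _] _] A B A0 B0 strong weak.
move=> f g fp gq.
have nfg0 : (0 <= lp_norm (lebesgue_tuple n) p f * lp_norm (lebesgue_tuple n) q g)%E.
  by rewrite mule_ge0// /lp_norm Lnorm_ge0.
have nfg_fin :
    (lp_norm (lebesgue_tuple n) p f * lp_norm (lebesgue_tuple n) q g)%E
    \is a fin_num.
  rewrite ge0_fin_numE//; have [_ _ fy] := fp; have [_ _ gy] := gq.
  by rewrite lte_mul_pinfty// ?ge0_fin_numE// /lp_norm Lnorm_ge0.
have := strong _ _ fp gq; have := weak _ _ fp gq.
rewrite -(fineK nfg_fin); set k := fine _ => weakfg strongfg.
have k0 : 0 <= k by rewrite fine_ge0.
set D := C * A `^ (1 - theta) * B `^ theta.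
have D0 : 0 < D by rewrite !mulr_gt0 ?powR_gt0.
have mh : measurable_fun [set: n.-tuple R] (cabs (bilinear_potential G f g)).
  have [mRf mIf _] := fp; have [mRg mIg _] := gq.
  exact: measurable_cabs_potential.
(* [l > 0] even if [k = 0]; with [l] in place of [k] the bound grows by exactly
   [e], because [D * l = D * k + e]. *)
apply/lee_addgt0Pr => e e0; pose l := k + e / D.
have l0 : 0 < l by rewrite ltr_wpDl// divr_gt0.
have kl : k <= l by rewrite lerDl divr_ge0 ?ltW.
have -> : (D%:E * k%:E + e%:E =
    (C * ((A * l) `^ (1 - theta) * (B * l) `^ theta))%:E)%E.
  rewrite -EFinM -EFinD; congr EFin.
  rewrite !powRM ?(ltW A0) ?(ltW B0) ?(ltW l0)//.
  transitivity (D * (l `^ (1 - theta) * l `^ theta)); last by rewrite /D; ring.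
  rewrite -powRD ?(gt_eqF l0) ?implybT// subrK powRr1 ?(ltW l0)//.
  by rewrite /l mulrDr mulrCA divff ?gt_eqF// mulr1.
rewrite /C -deE; apply: lorentz_interpolation => //.
- by rewrite r12 ltrDl.
- by rewrite theta_gt0.
- by rewrite mulr_gt0.
- by rewrite mulr_gt0.
- move=> t t0; apply: decreasing_rearr_le_lp_norm => //; first by rewrite mulr_gt0.
  by rewrite (le_trans strongfg)// -EFinM lee_fin ler_wpM2l// ltW.
- move=> t t0; apply: decreasing_rearr_le_lorentz_norm => //.
  by rewrite (le_trans weakfg)// -EFinM lee_fin ler_wpM2l// ltW.
Qed.
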